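(* Let $S$ be a connected closed subset of $\mathbb{R}^k$ and let $(f,X)$ be an i.i.d. random iteration of $J$-monotone continuous maps on $S$ satisfying the $J$-splitting condition. Then: (i) There is a measurable map $\pi\colon\Omega\to S$ such that for $\mathbb{P}$-almost every $\omega$ we have $$\pi(\omega)=\lim_{n\to\infty} f_{X_0(\omega)}\circ\cdots\circ f_{X_n(\omega)}(x)$$ for every $x\in S$. (ii) The probability measure $\pi\mathbb{P}$ is the unique stationary measure, and for every Borel probability measure $\varsigma$ on $S$ we have $$T^n\varsigma\to\pi\mathbb{P}\quad (n\to\infty)$$ in the weak-star topology, where $T$ is the Markov operator.
   Context: Setting. $(E,\nu)$ is a probability space; $X=\{X_n\}_{n\ge 0}$ is an i.i.d. sequence of $E$-valued random variables with common distribution $\nu$, defined on a probability space $(\Omega,\mathscr{F},\mathbb{P})$. Let $S\subset\mathbb{R}^k$, let $f\colon E\times S\to S$ be measurable, and write $f_\alpha(x)=f(\alpha,x)$. The pair $(f,X)$ is called an i.i.d. random iteration of maps; it is an i.i.d. random iteration of $J$-monotone continuous maps if every $f_\alpha\colon S\to S$ is continuous and $J$-monotone in the sense below. Order. Fix $J\subset\{1,\dots,k\}$. For $x,y\in\mathbb{R}^k$ write $x<_J y$ iff $x_i<y_i$ for all $i\in J$ and $x_i>y_i$ for all $i\notin J$. For subsets $S_1,S_2\subset\mathbb{R}^k$ write $S_1<_J S_2$ if $x<_J y$ for every $x\in S_1$, $y\in S_2$. A map $g\colon S\to S$ is $J$-increasing if $x<_J y\Rightarrow g(x)<_J g(y)$,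 $J$-decreasing if $x<_J y\Rightarrow g(y)<_J g(x)$, and $J$-monotone if it is either $J$-increasing or $J$-decreasing. $J$-splitting condition. $(f,X)$ satisfies the $J$-splitting condition if there are $m\in\mathbb{N}$, $m\ge1$, and measurable subsets $A,B$ of $E^m$ with $\nu^m(A)>0$ and $\nu^m(B)>0$ such that for every $(\alpha_0,\dots,\alpha_{m-1})\in A$ and $(\beta_0,\dots,\beta_{m-1})\in B$, $$f_{\alpha_0}\circ\cdots\circ f_{\alpha_{m-1}}(S)<_J f_{\beta_0}\circ\cdots\circ f_{\beta_{m-1}}(S).$$ Markov operator. The transition probability is $p(x,A)=\int \mathbf{1}_A(f_\alpha(x))\,d\nu(\alpha)$. The Markov operator $T$ acts on Borel probability measures on $S$ by $T\mu(A)=\int p(x,A)\,d\mu(x)$ for Borel $A\subset S$. A stationary measure is a probability measure $\mu$ on $S$ with $T\mu=\mu$. For measurable $\pi\colon\Omega\to S$, $\pi\mathbb{P}$ denotes its distribution: $\pi\mathbb{P}(A)=\mathbb{P}(\pi^{-1}(A))$. *)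

(* Defs.v *)
From HB Require Import structures.
From mathcomp Require Import all_boot all_order all_algebra.
From mathcomp Require Import all_classical all_reals all_analysis.
From mathcomp Require Import giry.
Import numFieldNormedType.Exports.

Set Implicit Arguments.
Unset Strict Implicit.
Unset Printing Implicit Defensive.

Import Order.TTheory GRing.Theory Num.Theory.

Local Open Scope classical_set_scope.
Local Open Scope ring_scope.

(* The subset S as a type of its own, with the topology induced by the ambient
   space and the corresponding Borel sigma-algebra. Measurable types are pointed
   in the library: the proof S0 that S is nonempty only serves to provide an
   (irrelevant) default point. *)
Definition substate (T : topologicalType) (S : set T) (S0 : S !=set0) : Type :=
  set_type S.

Section substate_instances.
Context (T : topologicalType) (S : set T) (S0 : S !=set0).

HB.instance Definition _ := Topological.copy (substate S0) (set_type S).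
HB.instance Definition _ := isPointed.Build (substate S0)
  (exist _ (projT1 (cid S0)) (mem_set (projT2 (cid S0)))).
HB.instance Definition _ :=
  Measurable.copy (substate S0) (g_sigma_algebraType (@open (substate S0))).

End substate_instances.

Section product_probability.
Context d1 d2 (T1 : measurableType d1) (T2 : measurableType d2) (R : realType)
  (P1 : probability T1 R) (P2 : probability T2 R).

Let prod := (P1 \x P2)%E.

HB.instance Definition _ := Measure.on prod.

Let prod_setT : prod setT = 1%E.
Proof.
rewrite -setXTT [LHS]product_measure1E//.
by rewrite -[RHS]mule1; congr (_ * _)%E; exact: probability_setT.
Qed.

HB.instance Definition _ := Measure_isProbability.Build _ _ _ prod prod_setT.

Definition product_probability : probability (T1 * T2)%type R := prod.

End product_probability.

Section tuple_cons.
Context d (E : measurableType d) (n : nat).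

Definition tuple_cons (z : E * n.-tuple E) : n.+1.-tuple E :=
  [tuple of z.1 :: z.2].

Lemma measurable_tuple_cons : measurable_fun [set: E * n.-tuple E] tuple_cons.
Proof. exact: (measurable_cons measurable_fst measurable_snd). Qed.

HB.instance Definition _ :=
  isMeasurableFun.Build _ _ _ _ tuple_cons measurable_tuple_cons.

End tuple_cons.

(* n-tuples carry the product sigma-algebra; this is the n-fold product of nu. *)
Fixpoint power_probability d (E : measurableType d) (R : realType)
    (nu : probability E R) n : probability (n.-tuple E) R :=
  match n with
  | 0 => dirac [tuple]
  | n.+1 => distribution (product_probability nu (power_probability nu n))
                         (@tuple_cons _ E n)
  end.

Section order.
Context (R : realType) (k : nat) (J : {set 'I_k}).

Definition ltJ (x y : 'rV[R]_k) : Prop :=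
  forall i : 'I_k, if i \in J then x ord0 i < y ord0 i
                   else y ord0 i < x ord0 i.

Definition set_ltJ (A B : set 'rV[R]_k) : Prop :=
  forall x y, A x -> B y -> ltJ x y.

Context (S : set 'rV[R]_k) (S0 : S !=set0).
Implicit Type g : substate S0 -> substate S0.

Definition J_increasing g : Prop :=
  forall x y, ltJ (set_val x) (set_val y) ->
    ltJ (set_val (g x)) (set_val (g y)).

Definition J_decreasing g : Prop :=
  forall x y, ltJ (set_val x) (set_val y) ->
    ltJ (set_val (g y)) (set_val (g x)).

Definition J_monotone g : Prop := J_increasing g \/ J_decreasing g.

End order.

(* the composition f_(a_0) \o ... \o f_(a_(n-1)) for s = [:: a_0; ...; a_(n-1)] *)
Definition maps_comp (E S : Type) (f : E * S -> S) (s : seq E) : S -> S :=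
  fun x => foldr (fun a y => f (a, y)) x s.

Definition J_splitting d (E : measurableType d) (R : realType) (k : nat)
    (J : {set 'I_k}) (S : set 'rV[R]_k) (S0 : S !=set0)
    (nu : probability E R) (f : E * substate S0 -> substate S0) : Prop :=
  exists (m : nat) (A B : set (m.-tuple E)),
    [/\ (1 <= m)%N, measurable A /\ measurable B,
        (0 < power_probability nu m A)%E, (0 < power_probability nu m B)%E &
        forall a b, A a -> B b ->
          set_ltJ J (range (fun x => set_val (maps_comp f a x)))
                    (range (fun x => set_val (maps_comp f b x)))].

Section iid.
Context dO dE (Omega : measurableType dO) (E : measurableType dE)
  (R : realType) (P : probability Omega R).

Definition mutually_independent (X : nat -> {RV P >-> E}) : Prop :=
  forall (s : seq nat) (A : nat -> set E), uniq s ->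
    (forall i, measurable (A i)) ->
    P (\bigcap_(i in [set` s]) (X i @^-1` A i)) =
    (\prod_(i <- s) P (X i @^-1` A i))%E.

Definition iid (nu : probability E R) (X : nat -> {RV P >-> E}) : Prop :=
  mutually_independent X /\ forall n, distribution P (X n) ≡μ nu.

End iid.

Section markov.
Context dE d (E : measurableType dE) (S : measurableType d) (R : realType)
  (nu : probability E R) (f : {mfun (E * S)%type >-> S}).
Local Open Scope ereal_scope.

Definition trans_prob (x : S) (A : set S) : \bar R :=
  \int[nu]_a (\1_A (f (a, x)))%:E.

Section operator.
Variable mu : probability S R.

Definition markov_meas (A : set S) : \bar R := \int[mu]_x trans_prob x A.

Let fswap (z : S * E) : S := f (z.2, z.1).

Let mfswap : measurable_fun [set: S * E] fswap.
Proof.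
apply: (measurableT_comp (measurable_funPT f)).
exact: (measurable_fun_pair measurable_snd measurable_fst).
Qed.

Let markov_measE A : measurable A -> markov_meas A = (mu \x nu) (fswap @^-1` A).
Proof.
move=> mA; apply: eq_integral => x _ /=.
have mB : measurable ((fun a => f (a, x)) @^-1` A).
  rewrite -[X in measurable X]setTI.
  by apply: (measurableT_comp (measurable_funPT f) (measurable_pair2 x)).
rewrite /trans_prob (_ : xsection _ _ = (fun a => f (a, x)) @^-1` A).
  by rewrite -[in RHS](setIT (_ @^-1` _)) -integral_indic.
by apply/seteqP; split => a; rewrite /xsection/= inE.
Qed.

Let markov_meas0 : markov_meas set0 = 0.
Proof. by rewrite markov_measE// preimage_set0 measure0. Qed.

Let markov_meas_ge0 A : 0 <= markov_meas A.
Proof.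
by apply: integral_ge0 => x _; apply: integral_ge0 => a _; rewrite lee_fin.
Qed.

Let markov_meas_sigma_additive : semi_sigma_additive markov_meas.
Proof.
move=> F mF tF mUF; rewrite markov_measE//.
rewrite (_ : (fun n => _) = fun n => \sum_(0 <= i < n)
    pushforward (mu \x nu) fswap (F i)); last first.
  by apply/funext => n; apply: eq_bigr => i _; rewrite markov_measE.
have := @measure_semi_sigma_additive _ _ _
  [the {measure set _ -> \bar R} of pushforward (mu \x nu) fswap] F mF tF mUF.
exact.
Qed.

HB.instance Definition _ := isMeasure.Build _ _ _ markov_meas
  markov_meas0 markov_meas_ge0 markov_meas_sigma_additive.

Let markov_meas_setT : markov_meas setT = 1.
Proof.
rewrite markov_measE// preimage_setT -setXTT product_measure1E//.
by rewrite -[RHS]mule1; congr (_ * _); exact: probability_setT.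
Qed.

HB.instance Definition _ :=
  Measure_isProbability.Build _ _ _ markov_meas markov_meas_setT.

Definition markov_op : probability S R := markov_meas.

End operator.

(* Library measures are functions on all sets, with arbitrary values on the
   non-measurable ones, so that measures are compared on measurable sets only. *)
Definition stationary (mu : probability S R) : Prop := markov_op mu ≡μ mu.

End markov.

Definition weak_cvg (R : realType) (T : topologicalType) (S : set T)
    (S0 : S !=set0) (mu_ : nat -> probability (substate S0) R)
    (mu : probability (substate S0) R) : Prop :=
  forall g : substate S0 -> R, continuous g -> bounded_fun g ->
    (\int[mu_ n]_x (g x)%:E @[n --> \oo] --> \int[mu]_x (g x)%:E)%E.

(* Main.v *)
Require Import Defs.
From mathcomp Require Import all_boot all_order all_algebra.
From mathcomp Require Import all_classical all_reals all_analysis.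
From mathcomp Require Import giry measurable_realfun.
From mathcomp Require Import lra.
Import numFieldNormedType.Exports.
Import Order.TTheory GRing.Theory Num.Theory.
Local Open Scope classical_set_scope.
Local Open Scope ring_scope.

Set Implicit Arguments.
Unset Strict Implicit.
Unset Printing Implicit Defensive.

(** Reading the maps backwards makes the ranges of f_(X_0) o ... o f_(X_(n-1))
    a decreasing sequence of sets, and the theorem says that almost surely they
    shrink to one point, coordinate by coordinate. Two things have to be ruled
    out: that a coordinate of the ranges keeps straddling some level t, and that
    the ranges run off to infinity.

    Straddling: if the composition along a word u straddles t in coordinate i,
    then u ++ a and u ++ b cannot both do so for a in A and b in B, because a
    J-monotone map keeps the ranges along a and b on opposite sides of each
    other (straddle_split). So every block of m further letters destroys the
    straddling with probability at least min (nu^m A) (nu^m B), whatever the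
    past, and straddling forever has probability zero (survival_null). This is
    used for the countably many rational levels t.

    Escape: for a in A and b in B the range along a ++ b or along a ++ a,
    according to whether the composition along a is increasing or decreasing,
    lies between two points for the order <_J (bounded_split). Hence a block of
    length 2m has a bounded range with positive probability. Since S is closed,
    bounded subsets of S are relatively compact and their continuous images are
    again bounded (bounded_suffix), so one bounded block anywhere makes all
    later ranges bounded; almost surely such a block occurs.

    A decreasing sequence of nonempty bounded sets of reals that eventually lies
    on one side of each rational shrinks to a point (nested_ranges_cvg), which
    gives the limit pi.

    For the Markov operator, T^n s is the law of f_(X_0) o ... o f_(X_(n-1)) (x)
    with x drawn from s independently of X (iter_markov_word; the order of the
    letters is irrelevant since they are exchangeable). Dominated convergence
    gives T^n s -> law of pi. Stationarity follows by computing the limit of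
    T^(n+1) s = T (T^n s) in two ways: as the law of pi, and, applying one more
    independent random map, as T (law of pi). Bounded continuous functions
    determine a Borel probability on S (measure_eq_continuous), so the two
    limits coincide, and a stationary measure, being its own T^n-image, can only
    be the law of pi. *)

(** * Coordinates and the topology of a closed subset of R^k *)

Section coordinates.
Context (R : realType) (k : nat) (S : set 'rV[R]_k) (S0 : S !=set0).
Local Notation T := (substate S0).

(** The state space is only reached through its coordinate functions: they carry
    its topology (nbhs_coord), its Borel sets (measurable_fun_coord) and its
    closedness in R^k (closed_coord). *)
Definition scoord (i : 'I_k) (x : T) : R := set_val x ord0 i.

Lemma coord_continuous_substate i : continuous (scoord i).
Proof.
move=> x; apply: (@continuous_comp T 'rV[R]_k R set_val (fun v => v ord0 i)).
  exact: (@initial_continuous (set_type S) 'rV[R]_k set_val).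
exact: coord_continuous.
Qed.

(** The traces on S of the open cubes with rational centre q and radius
    1 / (n + 1), a countable base of the topology. *)
Definition box (p : 'rV[rat]_k * nat) : set T :=
  [set x | forall i, ball (ratr (p.1 ord0 i) : R) p.2.+1%:R^-1 (scoord i x)].

Lemma nbhs_coord (x : T) (U : set T) : nbhs x U ->
  exists2 e : R, 0 < e &
    forall y, (forall i, `|scoord i y - scoord i x| < e) -> U y.
Proof.
move=> [_ [[V oV <-] /= Vx VU]].
have /nbhs_ballP[e /= e0 eV] : nbhs (set_val x) V by exact: open_nbhs_nbhs.
exists e => // y xy; apply/VU/eV; split=> // i j /=.
by rewrite (ord1 i) /ball/= distrC; exact: xy.
Qed.

Lemma box_nbhs (x : T) (U : set T) : nbhs x U ->
  exists p, box p x /\ box p `<=` U.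
Proof.
rewrite /box.
move=> /nbhs_coord[e e0 eU].
have [n ne] : exists n : nat, n.+1%:R^-1 < e / 2.
  have e20 : 0 < e / 2 by lra.
  have [n _ /(_ n (leqnn _)) ?] := near_infty_natSinv_lt (PosNum e20).
  by exists n.
have : 0 < n.+1%:R^-1 :> R by rewrite invr_gt0.
pose v : R := n.+1%:R^-1; rewrite -/v in ne * => v0.
have /choice[q xq] (i : 'I_k) : exists q : rat, `|ratr q - scoord i x| < v.
  have [|q] := @rat_in_itvoo R (scoord i x - v) (scoord i x + v); first by lra.
  rewrite in_itv/= => /andP[? ?]; exists q; rewrite ltr_norml; apply/andP; lra.
exists (\row_i q i, n); split=> [i|y yq] /=; first by rewrite mxE; exact: xq.
apply: eU => i; have := yq i; rewrite /ball/= mxE -/v => yqi.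
have -> : scoord i y - scoord i x =
  (ratr (q i) - scoord i x) - (ratr (q i) - scoord i y) by lra.
apply: (le_lt_trans (ler_normB _ _)); have := xq i; lra.
Qed.

Lemma cvg_coord (u : nat -> T) x :
  (forall i, scoord i (u n) @[n --> \oo] --> scoord i x) ->
  u n @[n --> \oo] --> x.
Proof.
move=> ux U /nbhs_coord[e e0 eU].
have : \forall n \near \oo, forall i, `|scoord i x - scoord i (u n)| < e.
  by apply: filter_forall => i; have /cvgrPdist_lt/(_ _ e0) := ux i.
by apply: filterS => n un; apply: eU => i; rewrite distrC.
Qed.

Lemma closed_coord (u : nat -> T) (l : 'I_k -> R) : closed S ->
  (forall i, scoord i (u n) @[n --> \oo] --> l i) ->
  exists x : T, forall i, scoord i x = l i.
Proof.
move=> clS ul; suff Sl : S (\row_i l i).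
  exists (SigSub (mem_set Sl)) => i.
  by rewrite /scoord set_valE /= mxE.
apply: (@closed_cvg _ _ \oo _ (fun n => set_val (u n)) S).
- exact: clS.
- by apply: nearW => n; apply: set_valP.
- move=> U /nbhs_ballP[e /= e0 eU].
  have : \forall n \near \oo, forall i, `|l i - scoord i (u n)| < e.
    by apply: filter_forall => i; have /cvgrPdist_lt/(_ _ e0) := ul i.
  apply: filterS => n un; apply: eU; split=> // i j; rewrite (ord1 i) /ball/= mxE.
  exact: un.
Qed.

(** The part of S inside a closed box of R^k is compact because S is closed. *)
Lemma continuous_bounded (h : T -> R) (M : 'I_k -> R) : closed S ->
  continuous h ->
  exists C, forall x, (forall i, `|scoord i x| <= M i) -> `|h x| <= C.
Proof.
move=> clS ch.
pose B := [set v : 'rV[R]_k |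
  forall i, (fun i => `[- M i, M i]%classic) i (v ord0 i)].
have cB : compact B by apply: rV_compact => i; exact: segment_compact.
have cSB : compact (S `&` B) by rewrite setIC; exact: compact_closedI.
pose h' := valL_ (0:R) (h : set_type S -> R).
have ch' : {within S, continuous h'}.
  by apply/subspace_valL_continuousP' => x; exact: ch.
have ch'' : {within S `&` B, continuous h'}.
  by apply: continuous_subspaceW ch' => x [].
have := continuous_compact ch'' cSB.
move=> /compact_bounded[C [_ Cb]].
exists (C + 1) => x xM.
have hx : h' (set_val x) = h x.
  exact: (congr1 (@^~ x) (valLK 0 h)).
rewrite -hx; apply: (Cb (C + 1)); first by rewrite ltrDl.
exists (set_val x) => //; split; first exact: set_valP.
by move=> i /=; rewrite in_itv/= -ler_norml; exact: xM.
Qed.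

Lemma continuous_measurable_substate (h : T -> R) :
  continuous h -> measurable_fun setT h.
Proof.
move=> ch; apply: (measurability _ (RGenOInfty.measurableE R)) => /=.
move=> _ [_ [a ->] <-]; rewrite setTI; apply: sub_sigma_algebra.
by apply: open_comp => [x _|]; [exact: ch|exact: interval_open].
Qed.

Lemma coord_measurable i : measurable_fun setT (scoord i).
Proof.
by apply: continuous_measurable_substate; exact: coord_continuous_substate.
Qed.

(** Countably many boxes suffice, so that open sets are measurable for any
    sigma-algebra that makes the coordinates measurable. *)
Lemma open_bigcup_box (U : set T) : open U ->
  U = \bigcup_(p in [set p | box p `<=` U]) box p.
Proof.
move=> oU; apply/seteqP; split=> [x Ux|x [p pU]]; last exact: pU.
by have [|p [px pU]] := @box_nbhs x U; [exact: open_nbhs_nbhs|exists p].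
Qed.

Lemma measurable_fun_coord d (Y : measurableType d) (g : Y -> T) :
  (forall i, measurable_fun setT (scoord i \o g)) -> measurable_fun setT g.
Proof.
move=> mg; apply: (@measurability _ _ _ _ _ _ (@open T)) => //.
move=> _ [U oU <-].
rewrite setTI (open_bigcup_box oU) preimage_bigcup bigcup_mkcond.
apply: countable_bigcupT_measurable => // p; case: ifP => // _.
rewrite (_ : _ @^-1` _ = \bigcap_(i : 'I_k)
  ((scoord i \o g) @^-1` ball (ratr (p.1 ord0 i) : R) p.2.+1%:R^-1)); last first.
  by apply/seteqP; split=> [x px i _|x px i]; exact: px.
apply: fin_bigcap_measurable => // i _.
rewrite -[X in measurable X]setTI; apply: mg => //; exact: measurable_ball.
Qed.

(** One point in each nonempty box (a default point when the box is empty): a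
    countable dense family, which turns quantifiers over S into countable unions
    and intersections. *)
Definition dense_pt (p : 'rV[rat]_k * nat) : T := get (box p).

Lemma dense_ptP (U : set T) x : open U -> U x -> exists p, U (dense_pt p).
Proof.
move=> oU Ux; have [|p [px pU]] := @box_nbhs x U; first exact: open_nbhs_nbhs.
by exists p; apply: pU; rewrite /dense_pt; apply: getPex; exists x.
Qed.

End coordinates.

(** * Powers of a probability measure *)

Section power.
Context d (E : measurableType d) (R : realType) (nu : probability E R).
Local Notation pw := (power_probability nu).

Definition tuple_box n (A : 'I_n -> set E) : set (n.-tuple E) :=
  [set t | forall i, A i (tnth t i)].

Definition tuple_boxes n : set_system (n.-tuple E) :=
  [set B | exists2 A : 'I_n -> set E,
    (forall i, measurable (A i)) & B = tuple_box A].

Lemma tuple_box_measurable n (A : 'I_n -> set E) :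
  (forall i, measurable (A i)) -> measurable (tuple_box A).
Proof.
move=> mA; rewrite (_ : tuple_box A =
  \bigcap_(i : 'I_n) ((@tnth n E)^~ i @^-1` A i)).
  apply: fin_bigcap_measurable => // i _; rewrite -[X in measurable X]setTI.
  exact: measurable_tnth.
by apply/seteqP; split=> [t ? i _|t tA i]; [|exact: tA].
Qed.

Lemma tuple_boxesE n : (@measurable _ (n.-tuple E)) = <<s @tuple_boxes n >>.
Proof.
apply/seteqP; split.
  apply: smallest_sub; first exact: smallest_sigma_algebra.
  rewrite -bigcup_seq => B [i _ [A mA <-]]; apply: sub_sigma_algebra.
  exists (fun j => if j == i then A else setT).
    by move=> j; case: ifP.
  apply/seteqP; split=> [t [_ At] j|t At] /=; first by case: eqP => // ->.
  by split => //; have := At i; rewrite eqxx.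
apply: smallest_sub; first exact: sigma_algebra_measurable.
by move=> _ [A mA ->]; exact: tuple_box_measurable.
Qed.

Lemma power_probability_box n (A : 'I_n -> set E) :
  (forall i, measurable (A i)) ->
  pw n (tuple_box A) = (\prod_(i < n) nu (A i))%E.
Proof.
elim: n A => [|n IH] A mA.
  by rewrite big_ord0 /= diracE mem_set // => -[].
rewrite big_ord_recl /= /distribution /pushforward.
rewrite (_ : _ @^-1` _ = A ord0 `*` tuple_box (fun i => A (lift ord0 i))).
  rewrite product_measure1E//; last by apply: tuple_box_measurable => i; exact: mA.
  by congr (_ * _)%E; apply: (IH (fun i => A (lift ord0 i))) => i; exact: mA.
apply/seteqP; split=> [[a t] /= At|[a t] /= [Aa At] i].
  by split=> [|i]; [exact: (At ord0)|have := At (lift ord0 i); rewrite tnthS].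
case: (unliftP ord0 i) => [j|] ->; last exact: Aa.
by rewrite tnthS; exact: At.
Qed.

(** Boxes form a pi-system that generates the sigma-algebra of tuples. This is
    how the law of a block of the sequence X and the law of a concatenation are
    both identified with a power of nu. *)
Lemma power_probability_unique n (m : {measure set (n.-tuple E) -> \bar R}) :
  (forall A : 'I_n -> set E, (forall i, measurable (A i)) ->
     m (tuple_box A) = (\prod_(i < n) nu (A i))%E) ->
  forall G, measurable G -> m G = pw n G.
Proof.
move=> mE G mG.
apply: (@measure_unique _ _ _ (@tuple_boxes n) (fun=> setT)) => //.
- exact: tuple_boxesE.
- move=> _ _ [A mA ->] [B mB ->]; exists (fun i => A i `&` B i).
    by move=> i; exact: measurableI.
  apply/seteqP; split=> [t [At Bt] i|t ABt]; first by split.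
  by split=> i; have [] := ABt i.
- by move=> _; exists (fun=> setT) => //; apply/seteqP; split.
- by rewrite bigcup_const//; exists 0%N.
- by move=> _ [A mA ->]; rewrite mE//; symmetry; exact: power_probability_box.
- move=> _; have -> : [set: n.-tuple E] = tuple_box (fun=> setT).
    by apply/seteqP; split.
  rewrite mE// (eq_bigr (fun=> 1%E)); last by move=> i _; exact: probability_setT.
  by rewrite big1 ?ltry.
Qed.

Lemma measurable_cat_tuple n m : measurable_fun setT
  (fun z : n.-tuple E * m.-tuple E => [tuple of z.1 ++ z.2]).
Proof.
apply/measurable_fun_tnthP => i; case: (split_ordP i) => j ->.
  rewrite (_ : _ \o _ = (fun t => tnth t j) \o fst).
    by apply: measurableT_comp => //; exact: measurable_tnth.
  by apply/funext => z /=; rewrite tnth_lshift.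
rewrite (_ : _ \o _ = (fun t => tnth t j) \o snd).
  by apply: measurableT_comp => //; exact: measurable_tnth.
by apply/funext => z /=; rewrite tnth_rshift.
Qed.

Lemma measurable_cat_preimage n m (G : set ((n + m).-tuple E)) : measurable G ->
  measurable [set z : n.-tuple E * m.-tuple E | G [tuple of z.1 ++ z.2]].
Proof.
by move=> mG; have := @measurable_cat_tuple n m measurableT _ mG; rewrite setTI.
Qed.

Lemma measurable_cat_section n m (u : n.-tuple E) (G : set ((n + m).-tuple E)) :
  measurable G -> measurable [set v : m.-tuple E | G [tuple of u ++ v]].
Proof.
move=> /measurable_cat_preimage/(measurable_xsection u).
by congr measurable; apply/seteqP; split=> v /=; rewrite /xsection/= inE.
Qed.

(** A word of length n + m is a word of length n followed by an independent one
    of length m. *)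
Lemma power_probability_cat n m (G : set ((n + m).-tuple E)) : measurable G ->
  pw (n + m) G = (pw n \x pw m)%E
    [set z : n.-tuple E * m.-tuple E | G [tuple of z.1 ++ z.2]].
Proof.
move=> mG; pose c := mfun_Sub (mem_set (@measurable_cat_tuple n m)).
rewrite -(@power_probability_unique _
  (distribution (product_probability (pw n) (pw m)) c))//.
move=> A mA; rewrite /distribution /pushforward /=.
rewrite (_ : _ @^-1` _ = tuple_box (fun i => A (lshift m i)) `*`
                         tuple_box (fun i => A (rshift n i))).
  rewrite product_measure1E; try by apply: tuple_box_measurable => i; exact: mA.
  by rewrite big_split_ord; congr (_ * _)%E;
     apply: power_probability_box => i; exact: mA.
apply/seteqP; split=> [[u v] /= Auv|[u v] /= [Au Av] i].
  split=> i; [have := Auv (lshift m i)|have := Auv (rshift n i)].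
    by rewrite tnth_lshift.
  by rewrite tnth_rshift.
case: (split_ordP i) => j ->; first by rewrite tnth_lshift; exact: Au.
by rewrite tnth_rshift; exact: Av.
Qed.

End power.

(** * Events that survive every block of letters *)

Section survival.
Context dO dE (Omega : measurableType dO) (E : measurableType dE)
  (R : realType) (P : probability Omega R) (nu : probability E R)
  (X : nat -> {RV P >-> E}).
Local Notation pw := (power_probability nu).

Definition word n (w : Omega) : n.-tuple E :=
  map_tuple (X ^~ w) (iota_tuple n 0).

Lemma tnth_word n w (i : 'I_n) : tnth (word n w) i = X i w.
Proof. by rewrite tnth_map (tnth_nth 0%N) /= nth_iota. Qed.

Lemma measurable_word n : measurable_fun setT (word n).
Proof.
apply/measurable_fun_tnthP => i.
by rewrite (_ : _ \o _ = X i)//; apply/funext => w /=; exact: tnth_word.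
Qed.

Hypothesis iidX : iid nu X.

(** Identical distribution and independence enter the proof only here, and only
    for the words that start at time 0. *)
Lemma word_law n G : measurable G -> P [set w | G (word n w)] = pw n G.
Proof.
case: iidX => indX lawX mG.
pose c := mfun_Sub (mem_set (@measurable_word n)).
rewrite -(@power_probability_unique _ _ _ nu _ (distribution P c))//.
move=> A mA; rewrite /distribution /pushforward /=.
pose A' (j : nat) : set E := if insub j is Some i then A i else setT.
have A'E (i : 'I_n) : A' i = A i by rewrite /A' valK.
have mA' j : measurable (A' j) by rewrite /A'; case: insub.
transitivity (P (\bigcap_(i in [set` iota 0 n]) (X i @^-1` A' i))); last first.
  rewrite indX ?iota_uniq// -{1}(subn0 n) big_mkord.
  by apply: eq_bigr => i _; rewrite A'E; exact: lawX.
congr (P _); apply/seteqP; split=> [w At j /=|w At i /=].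
  rewrite mem_iota add0n => jn; have := At (Ordinal jn).
  by rewrite tnth_word /= -(A'E (Ordinal jn)).
by rewrite tnth_word -A'E; apply: At; rewrite /= mem_iota /=.
Qed.

Lemma le_expr_le0 (x : \bar R) (c : R) : 0 <= c < 1 ->
  (forall q, (x <= (c ^+ q)%:E)%E) -> (x <= 0)%E.
Proof.
move=> /andP[c0 c1] xc.
have cvg0 : (c ^+ q)%:E @[q --> \oo] --> 0%E.
  by apply: cvg_EFin; [exact: nearW|apply: cvg_expr; rewrite ger0_norm].
rewrite -(cvg_lim _ cvg0)//; apply: lime_ge; last exact: nearW.
exact: cvgP cvg0.
Qed.

Section decay.
Variables (Q : seq E -> Prop) (m : nat) (c : R).
Hypothesis c01 : 0 <= c < 1.
Hypothesis mQ : forall n, measurable [set u : n.-tuple E | Q u].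
Hypothesis Qprefix : forall u v, Q (u ++ v) -> Q u.
Hypothesis Qdecay : forall n (u : n.-tuple E), Q u ->
  (pw m [set v : m.-tuple E | Q (u ++ v)] <= c%:E)%E.

(** Condition on the first n letters: a word of length n + m satisfies Q only if
    its prefix does, and then the last m letters keep Q with probability at most
    c. *)
Lemma power_decay n : (pw (n + m) [set u : (n + m).-tuple E | Q u] <=
  c%:E * pw n [set u : n.-tuple E | Q u])%E.
Proof.
rewrite power_probability_cat//.
have c0 : (0 <= c%:E)%E by rewrite lee_fin; case/andP: c01.
have -> : (c%:E * pw n [set u : n.-tuple E | Q u] =
    \int[pw n]_u (c%:E * (\1_[set u : n.-tuple E | Q u] u)%:E))%E.
  rewrite ge0_integralZl_EFin//.
  - rewrite integral_indic; [by rewrite setIT|by []|exact: mQ].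
  - by apply/measurable_EFinP; apply: measurable_indic; exact: mQ.
rewrite /product_measure1; apply: ge0_le_integral => //.
- apply: measurable_fun_xsection.
  exact: measurable_cat_preimage (@mQ (n + m)%N).
- apply: measurable_funeM; apply/measurable_EFinP; apply: measurable_indic.
  exact: mQ.
move=> u _ /=; rewrite indicE.
have -> : xsection [set z : n.-tuple E * m.-tuple E | Q [tuple of z.1 ++ z.2]] u
  = [set v : m.-tuple E | Q (u ++ v)].
  by apply/seteqP; split=> v /=; rewrite /xsection/= inE.
have [/set_mem Qu|/negP nQu] := boolP (u \in _); first by rewrite mule1 Qdecay.
rewrite mule0 (_ : mkset _ = set0) ?measure0//.
by apply/seteqP; split=> // v /Qprefix Qu; apply: nQu; rewrite inE.
Qed.

(** After q blocks of m letters the probability that Q still holds is at most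
    c ^ q. *)
Lemma survival_null : P [set w | forall n, Q (word n w)] = 0%E.
Proof.
have mW n : measurable [set w | Q (word n w)].
  rewrite -[X in measurable X]setTI.
  exact: (@measurable_word n measurableT [set u : n.-tuple E | Q u] (@mQ _)).
apply/eqP; rewrite eq_le measure_ge0 andbT.
apply: (le_expr_le0 c01) => q.
pose N := iter q (addn^~ m) 0%N.
apply: (@le_trans _ _ (P [set w | Q (word N w)])).
  apply: le_measure; rewrite ?inE//; last by move=> w; exact.
  rewrite (_ : mkset _ = \bigcap_n [set w | Q (word n w)]).
    exact: bigcapT_measurable.
  by apply/seteqP; split=> [w Qw i _|w Qw i]; exact: Qw.
rewrite [leLHS](@word_law N _ (@mQ N)) /N {N}.
elim: q => [|q IH]; first by rewrite expr0; apply: probability_le1; exact: mQ.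
rewrite iterS (le_trans (power_decay _))// exprS EFinM lee_wpmul2l//.
by rewrite lee_fin; case/andP: c01.
Qed.

End decay.
End survival.

(** * Compositions of monotone continuous maps *)

(** The common limit is the supremum of the levels t that some range, hence all
    later ones, lies above. A rational slightly larger than this supremum is not
    such a level, so that some range lies below it. *)
Lemma nested_ranges_cvg (R : realType) (T : Type) (x0 : T) (h : nat -> T -> R) :
  (forall n n' x, (n <= n')%N -> exists y, h n' x = h n y) ->
  (exists n M, forall x, `|h n x| <= M) ->
  (forall q : rat, exists n,
     (forall x, ratr q <= h n x) \/ (forall x, h n x <= ratr q)) ->
  exists l : R, forall x, h n x @[n --> \oo] --> l.
Proof.
move=> nest [n0 [M hM]] hq.
pose A := [set t : R | exists n, forall x, t <= h n x].
have Aub : ubound A M.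
  move=> t [n tn]; have hM' x := le_trans (ler_norm _) (hM x).
  have [n0n|/ltnW nn0] := leqP n0 n.
    by have [y hy] := nest _ _ x0 n0n; rewrite (le_trans (tn x0))// hy.
  by have [y hy] := nest _ _ x0 nn0; rewrite (le_trans (tn y))// -hy.
have A0 : A !=set0.
  by exists (- M), n0 => x; have := hM x; rewrite ler_norml => /andP[].
have sA : has_sup A by split => //; exists M.
exists (sup A) => x; apply/cvgrPdist_le => e e0.
have [t [n1 tn1] et] := sup_adherent e0 sA.
have [|s] := @rat_in_itvoo R (sup A) (sup A + e); first by rewrite ltrDl.
rewrite in_itv/= => /andP[As se]; have [n2 sn2] := hq s.
have {}sn2 y : h n2 y <= ratr s.
  case: sn2 => [sn2|]; last exact.
  have : ratr s <= sup A by apply: ub_le_sup; [exists M|exists n2].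
  by rewrite leNgt As.
exists (maxn n1 n2) => // n /=; rewrite geq_max => /andP[n1n n2n].
have [y1 hy1] := nest _ _ x n1n; have [y2 hy2] := nest _ _ x n2n.
have := tn1 y1; have := sn2 y2; rewrite -hy1 -hy2 ler_norml => ? ?.
by apply/andP; split; lra.
Qed.

Section dynamics.
Context (R : realType) (k : nat) (J : {set 'I_k}) (S : set 'rV[R]_k)
  (S0 : S !=set0) (dE : measure_display) (E : measurableType dE)
  (f : {mfun (E * substate S0)%type >-> substate S0}).
Local Notation T := (substate S0).

Lemma maps_comp_cat u v (x : T) :
  maps_comp f (u ++ v) x = maps_comp f u (maps_comp f v x).
Proof. by rewrite /maps_comp foldr_cat. Qed.

Lemma measurable_maps_comp d (Y : measurableType d) (I : Type) (l : seq I)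
  (Z : I -> Y -> E) (g : Y -> T) :
  (forall i, measurable_fun setT (Z i)) -> measurable_fun setT g ->
  measurable_fun setT (fun y => maps_comp f [seq Z i y | i <- l] (g y)).
Proof.
move=> mZ mg; elim: l => //= i l IH.
apply: (measurableT_comp (measurable_funPT f)).
exact: (measurable_fun_pair (mZ i) IH).
Qed.

Lemma measurable_maps_comp_tuple n :
  measurable_fun setT (fun z : n.-tuple E * T => maps_comp f z.1 z.2).
Proof.
rewrite (_ : (fun z => _) = (fun z : n.-tuple E * T =>
  maps_comp f [seq tnth z.1 i | i <- enum 'I_n] z.2)).
  apply: measurable_maps_comp => // i.
  apply: (@measurableT_comp _ _ _ _ _ _ (fun t : n.-tuple E => tnth t i)) => //.
  exact: measurable_tnth.
by apply/funext => z; rewrite map_tnth_enum.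
Qed.

Lemma measurable_maps_coord n i x :
  measurable_fun setT (fun u : n.-tuple E => scoord i (maps_comp f u x)).
Proof.
apply: (@measurableT_comp _ _ _ _ _ _ (scoord i) _
  (fun u : n.-tuple E => maps_comp f u x)); first exact: coord_measurable.
exact: (measurableT_comp (@measurable_maps_comp_tuple n)
  (measurable_fun_pair (@measurable_id _ _ setT) (measurable_cst x))).
Qed.

Hypothesis fcont : forall a : E, continuous (fun x : T => f (a, x)).
Hypothesis fmono : forall a : E, J_monotone J (fun x : T => f (a, x)).

Lemma maps_comp_continuous u : continuous (maps_comp f u).
Proof.
elim: u => [|a u IH] x; first exact: cvg_id.
apply: (@continuous_comp _ _ _ (maps_comp f u) (fun x => f (a, x))).
  exact: IH.
exact: fcont.
Qed.

Lemma maps_coord_continuous u i :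
  continuous (fun x => scoord i (maps_comp f u x)).
Proof.
move=> x; apply: (@continuous_comp _ _ _ (maps_comp f u) (scoord i)).
  exact: maps_comp_continuous.
exact: coord_continuous_substate.
Qed.

Lemma maps_comp_monotone u : J_monotone J (maps_comp f u).
Proof.
elim: u => [|a u [] IH]; first by left.
  by case: (fmono a) => fa; [left|right] => x y xy /=; apply: fa; exact: IH.
by case: (fmono a) => fa; [right|left] => x y xy /=; apply: fa; exact: IH.
Qed.

(** With strict inequalities this is an open condition on x and y, so that it can
    be tested on a countable dense family. *)
Definition straddle i (t : R) (u : seq E) : Prop :=
  (exists x, scoord i (maps_comp f u x) < t) /\
  (exists y, t < scoord i (maps_comp f u y)).

Definition bounded_image (u : seq E) : Prop :=
  forall i, exists M, forall x, `|scoord i (maps_comp f u x)| <= M.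

Lemma straddle_prefix i t u v : straddle i t (u ++ v) -> straddle i t u.
Proof.
move=> [[x xt] [y yt]]; rewrite !maps_comp_cat in xt yt.
by split; [exists (maps_comp f v x)|exists (maps_comp f v y)].
Qed.

Lemma bounded_prefix u v : bounded_image u -> bounded_image (u ++ v).
Proof.
by move=> bu i; have [M uM] := bu i; exists M => x; rewrite maps_comp_cat.
Qed.

(** The range of the inner map lies in a compact part of S, on which the outer
    map is bounded by continuity. *)
Lemma bounded_suffix u v : closed S -> bounded_image v -> bounded_image (u ++ v).
Proof.
move=> clS /choice[M vM] i.
have [C uC] := continuous_bounded M clS (@maps_coord_continuous u i).
by exists C => x; rewrite maps_comp_cat; apply: uC => j; exact: vM.
Qed.

Lemma open_exists_dense (h : T -> R) (U : set R) x : continuous h -> open U ->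
  U (h x) -> exists p, U (h (dense_pt S0 p)).
Proof.
move=> ch oU Ux; apply: (@dense_ptP _ _ _ _ (h @^-1` U) x) => //.
by apply: open_comp => // y _; exact: ch.
Qed.

Lemma measurable_straddle n i t :
  measurable [set u : n.-tuple E | straddle i t u].
Proof.
have mex (U : set R) : open U ->
    measurable [set u : n.-tuple E | exists x, U (scoord i (maps_comp f u x))].
  move=> oU; rewrite (_ : mkset _ = \bigcup_p
      ((fun u : n.-tuple E => scoord i (maps_comp f u (dense_pt S0 p))) @^-1` U)).
    apply: countable_bigcupT_measurable => // p.
    rewrite -[X in measurable X]setTI; apply: measurable_maps_coord => //.
    exact: open_measurable.
  apply/seteqP; split=> [u [x Ux]|u [p _ Up]]; last by exists (dense_pt S0 p).
  have [p Up] := open_exists_dense (@maps_coord_continuous u i) oU Ux.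
  by exists p.
exact: (measurableI _ _ (mex [set r | r < t] (@open_lt _ _))
  (mex [set r | t < r] (@open_gt _ _))).
Qed.

Lemma measurable_bounded n :
  measurable [set u : n.-tuple E | bounded_image u].
Proof.
rewrite (_ : mkset _ = \bigcap_(i : 'I_k) \bigcup_(M : nat) ~` \bigcup_p
  ((fun u : n.-tuple E => scoord i (maps_comp f u (dense_pt S0 p))) @^-1`
    [set r | M%:R < `|r|])).
  apply: fin_bigcap_measurable => // i _; apply: bigcupT_measurable => M.
  apply: measurableC; apply: countable_bigcupT_measurable => // p.
  rewrite -[X in measurable X]setTI; apply: measurable_maps_coord => //.
  apply: open_measurable.
  apply: (@open_comp _ _ (@Num.norm _ R) [set r : R | M%:R < r]).
    by move=> x _; exact: norm_continuous.
  exact: open_gt.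
apply/seteqP; split=> [u bu i _|u bu i].
  have [M uM] := bu i; exists (Num.truncn M).+1 => // -[p _ /=].
  apply/negP; rewrite -leNgt (le_trans (uM _))//; exact/ltW/truncnS_gt.
have [M _ uM] := bu i Logic.I; exists M%:R => x; rewrite leNgt; apply/negP => Mx.
apply: uM; have [] := @open_exists_dense _ [set r | M%:R < `|r|] x
  (@maps_coord_continuous u i).
- apply: (@open_comp _ _ (@Num.norm _ R) [set r : R | M%:R < r]); last exact: open_gt.
  by move=> y _; exact: norm_continuous.
- exact: Mx.
- by move=> p ?; exists p.
Qed.

End dynamics.

(** * Consequences of splitting *)

Section splitting.
Context (R : realType) (k : nat) (J : {set 'I_k}) (S : set 'rV[R]_k)
  (S0 : S !=set0) (dE : measure_display) (E : measurableType dE)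
  (nu : probability E R)
  (f : {mfun (E * substate S0)%type >-> substate S0}).
Hypothesis fcont : forall a : E, continuous (fun x : substate S0 => f (a, x)).
Hypothesis fmono : forall a : E, J_monotone J (fun x : substate S0 => f (a, x)).
Local Notation T := (substate S0).
Local Notation pw := (power_probability nu).
Local Notation F := (maps_comp f).

Section blocks.
Variables (m : nat) (A B : set (m.-tuple E)).
Hypothesis splitAB : forall a b x y, A a -> B b ->
  ltJ J (set_val (F a x)) (set_val (F b y)).

(** If u ++ a and u ++ b both straddled t, each of the two ranges would have
    points on either side of t in coordinate i. But f_u, being monotone for the
    order <_J, sends the ordered ranges along a and b to ranges one of which
    lies entirely below the other in that coordinate. *)
Lemma straddle_split i t u :
  (forall a, A a -> ~ straddle f i t (u ++ a)) \/
  (forall b, B b -> ~ straddle f i t (u ++ b)).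
Proof.
have [[b [Bb sb]]|/forallNP nB] :=
  pselect (exists b, B b /\ straddle f i t (u ++ b)); last first.
  by right=> b Bb sb; apply: (nB b).
(* Each side compares the low point of one range with the high point of the
   other; which of the two is contradictory depends on the direction of f_u and
   on whether i belongs to J. *)
left=> a Aa sa; move: sa sb => [[x1]] + [y1] + [[x2] + [y2]].
rewrite !maps_comp_cat => x1t ty1 x2t ty2.
have side1 := splitAB y1 x2 Aa Bb; have side2 := splitAB x1 y2 Aa Bb.
case: (maps_comp_monotone fmono u) => Fu.
  have := Fu _ _ side1 i; have := Fu _ _ side2 i; rewrite -!/(scoord _ _).
  by case: ifP => _; lra.
have := Fu _ _ side1 i; have := Fu _ _ side2 i; rewrite -!/(scoord _ _).
by case: ifP => _; lra.
Qed.

(** Ranges along A lie below all ranges along B, which gives an upper bound in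
    both cases. For the lower bound, compare the point to which f_a is applied
    with a fixed point that f_a sends lower: one along A if f_a is increasing,
    and then the point must come from B; one along B if f_a is decreasing, and
    then the point must come from A. *)
Lemma bounded_split (a a' b' : m.-tuple E) : A a -> A a' -> B b' ->
  bounded_image f (a ++ b') \/ bounded_image f (a ++ a').
Proof.
move=> Aa Aa' Bb'.
have between (lo hi : T) v : (forall x, ltJ J (set_val lo) (set_val (F v x))) ->
   (forall x, ltJ J (set_val (F v x)) (set_val hi)) -> bounded_image f v.
  move=> lov vhi i; exists (`|scoord i lo| + `|scoord i hi|) => x.
  have := lov x i; have := vhi x i; rewrite -!/(scoord _ _).
  have := ler_norm (scoord i hi); have := ler_norm (- scoord i hi).
  have := ler_norm (scoord i lo); have := ler_norm (- scoord i lo).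
  rewrite !normrN ler_norml => h1 h2 h3 h4 h5 h6; apply/andP; move: h5 h6.
  by case: ifP => _ h5 h6; split; lra.
pose x0 : T := point.
case: (maps_comp_monotone fmono a) => Fa; [left|right].
  apply: (between (F a (F a x0)) (F b' x0)) => x; rewrite maps_comp_cat.
    by apply: Fa; exact: splitAB.
  exact: splitAB.
apply: (between (F a (F b' x0)) (F b' x0)) => x; rewrite maps_comp_cat.
  by apply: Fa; exact: splitAB.
exact: splitAB.
Qed.

Hypotheses (mA : measurable A) (mB : measurable B).
Hypotheses (A0 : (0 < pw m A)%E) (B0 : (0 < pw m B)%E).

Let fine_gt0 (C : set (m.-tuple E)) : measurable C -> (0 < pw m C)%E ->
  [/\ 0 < fine (pw m C), fine (pw m C) <= 1 & pw m C = (fine (pw m C))%:E].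
Proof.
move=> mC C0; have Cfin : pw m C \is a fin_num by exact: fin_num_measure.
rewrite fineK//; split=> //; first by rewrite -lte_fin fineK.
by rewrite -lee_fin fineK//; exact: probability_le1.
Qed.

Lemma straddle_decay : exists2 c : R, 0 <= c < 1 & forall n (u : n.-tuple E) i t,
  (pw m [set v : m.-tuple E | straddle f i t (u ++ v)] <= c%:E)%E.
Proof.
have [a0 a1 aE] := fine_gt0 mA A0; have [b0 b1 bE] := fine_gt0 mB B0.
set a := fine _ in a0 a1 aE; set b := fine _ in b0 b1 bE.
have m0 : 0 < Num.min a b by rewrite lt_min a0.
have m1 : Num.min a b <= 1 by rewrite ge_min a1.
exists (1 - Num.min a b); first by apply/andP; split; lra.
move=> n u i t.
have avoid (C : set (m.-tuple E)) (mC : measurable C) :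
    (forall v, C v -> ~ straddle f i t (u ++ v)) ->
    (pw m [set v : m.-tuple E | straddle f i t (u ++ v)] <= 1 - pw m C)%E.
  move=> CN; rewrite -probability_setC//; apply: le_measure.
  - rewrite inE.
    have H := @measurable_straddle _ _ _ _ _ _ _ fcont (n + m)%N i t.
    exact: (@measurable_cat_section _ E n m u _ H).
  - by rewrite inE; exact: measurableC.
  - by move=> v sv Cv; exact: CN Cv sv.
have [/(avoid _ mA)|/(avoid _ mB)] := straddle_split i t u => /le_trans; apply.
  by rewrite aE -EFinB lee_fin lerD2l lerN2 ge_min lexx.
by rewrite bE -EFinB lee_fin lerD2l lerN2 ge_min lexx orbT.
Qed.

(** For each first half a in A, all the second halves in A or all those in B
    make the range bounded; hence a bounded range has probability at least
    nu^m(A) * min (nu^m(A), nu^m(B)). *)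
Lemma unbounded_block_lt1 : exists2 c : R, 0 <= c < 1 &
  (pw (m + m) [set v : (m + m).-tuple E | ~ bounded_image f v] <= c%:E)%E.
Proof.
have [a0 a1 aE] := fine_gt0 mA A0; have [b0 b1 bE] := fine_gt0 mB B0.
set a := fine _ in a0 a1 aE; set b := fine _ in b0 b1 bE.
have mbd n : measurable [set u : n.-tuple E | bounded_image f u].
  exact: measurable_bounded.
have c0 : 0 < a * Num.min a b by rewrite mulr_gt0// lt_min a0.
have c1 : a * Num.min a b <= 1.
  by rewrite -[1]mulr1 ler_pM// ?(ltW a0)// ?ge_min ?a1// le_min !ltW.
exists (1 - a * Num.min a b); first by apply/andP; lra.
suff : ((a * Num.min a b)%R%:E <=
    pw (m + m) [set v : (m + m).-tuple E | bounded_image f v])%E.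
  have -> : [set v : (m + m).-tuple E | ~ bounded_image f v] =
    ~` [set v | bounded_image f v] by [].
  rewrite probability_setC; last exact: mbd.
  by move=> le; rewrite EFinB leeB.
rewrite power_probability_cat// EFinM /product_measure1.
have -> : (a%:E * (Num.min a b)%:E =
    \int[pw m]_u ((Num.min a b)%:E * (\1_A u)%:E))%E.
  rewrite ge0_integralZl_EFin//.
  - by rewrite integral_indic// setIT muleC -aE.
  - by apply/measurable_EFinP; exact: measurable_indic.
  - by rewrite le_min !ltW.
apply: ge0_le_integral => //.
- by move=> u _; rewrite mule_ge0// lee_fin// le_min !ltW.
- by apply: measurable_funeM; apply/measurable_EFinP; exact: measurable_indic.
- apply: measurable_fun_xsection.
  exact: measurable_cat_preimage (@mbd (m + m)%N).
move=> u _ /=; rewrite indicE.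
have [/set_mem Au|_] := boolP (u \in A); last by rewrite mule0.
have sect (C : set (m.-tuple E)) : measurable C ->
    (forall v, C v -> bounded_image f (u ++ v)) ->
    (pw m C <= pw m (xsection [set z : m.-tuple E * m.-tuple E |
       [set v : (m + m).-tuple E | bounded_image f v] [tuple of z.1 ++ z.2]] u))%E.
  move=> mC Cb; apply: le_measure; rewrite ?inE//.
    apply: measurable_xsection.
    exact: measurable_cat_preimage (@mbd (m + m)%N).
  by move=> v Cv; rewrite /xsection/= inE; exact: Cb.
rewrite mule1.
have [allb|] := pselect (forall v, B v -> bounded_image f (u ++ v)).
  by apply: le_trans (sect _ mB allb); rewrite bE lee_fin ge_min lexx orbT.
move=> /existsNP[b' /not_implyP[Bb' nb']].
apply: (@le_trans _ _ (pw m A)); first by rewrite aE lee_fin ge_min lexx.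
by apply: sect => // v Av; have [] := bounded_split Au Av Bb'.
Qed.

End blocks.
End splitting.

(** * The almost sure limit *)

Section convergence.
Context (R : realType) (k : nat) (J : {set 'I_k}) (S : set 'rV[R]_k)
  (S0 : S !=set0) (clS : closed S) (dE : measure_display) (E : measurableType dE)
  (nu : probability E R) (dO : measure_display) (Omega : measurableType dO)
  (P : probability Omega R) (X : nat -> {RV P >-> E}) (iidX : iid nu X)
  (f : {mfun (E * substate S0)%type >-> substate S0}).
Hypothesis fcont : forall a : E, continuous (fun x : substate S0 => f (a, x)).
Hypothesis fmono : forall a : E, J_monotone J (fun x : substate S0 => f (a, x)).
Hypothesis fsplit : J_splitting J nu f.
Local Notation T := (substate S0).
Local Notation F n w := (maps_comp f (word X n w)).

Lemma word_prefix n n' w : (n <= n')%N ->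
  exists v, word X n' w = word X n w ++ v :> seq E.
Proof.
move=> nn'; exists [seq X i w | i <- iota n (n' - n)] => /=.
by rewrite -map_cat -iotaD subnKC.
Qed.

Lemma measurable_maps_word n x : measurable_fun setT (fun w => F n w x).
Proof.
exact: (@measurable_maps_comp _ _ _ _ _ _ f _ _ _ (iota 0 n)
  (fun i => X i : Omega -> E) (cst x)).
Qed.

(** Countably many survival events, one for each coordinate and rational level
    and one for unboundedness, are null. *)
Lemma shrinking_ae : exists N : set Omega, [/\ measurable N, P N = 0%E &
  forall w, ~ N w -> (exists n, bounded_image f (word X n w)) /\
    forall i (q : rat), exists n, ~ straddle f i (ratr q) (word X n w)].
Proof.
have [m [A [B [m0 [mA mB] A0 B0 AB]]]] := fsplit.
have splitAB a b (x y : T) : A a -> B b ->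
    ltJ J (set_val (maps_comp f a x)) (set_val (maps_comp f b y)).
  by move=> Aa Bb; apply: (AB a b Aa Bb); [exists x|exists y].
have [c1 c101 strd] := straddle_decay fcont fmono splitAB mA mB A0 B0.
have [c2 c201 bnd] := unbounded_block_lt1 fcont fmono splitAB mA mB A0 B0.
have null_bnd : P [set w | forall n, ~ bounded_image f (word X n w)] = 0%E.
  apply: (survival_null iidX (Q := fun u => ~ bounded_image f u) c201).
  - by move=> n; apply: measurableC; exact: measurable_bounded.
  - by move=> u v + bu; apply; exact: bounded_prefix.
  - move=> n u _; apply: le_trans bnd; apply: le_measure; rewrite ?inE.
    + exact: (@measurable_cat_section _ E n (m + m)%N u _
        (measurableC (@measurable_bounded _ _ _ _ _ _ _ fcont (n + (m + m))%N))).
    + by apply: measurableC; exact: measurable_bounded.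
    + by move=> v /= + bv; apply; exact: bounded_suffix.
have null_str i (q : rat) :
    P [set w | forall n, straddle f i (ratr q) (word X n w)] = 0%E.
  apply: (survival_null iidX (Q := straddle f i (ratr q)) c101).
  - by move=> n; exact: measurable_straddle.
  - by move=> u v; exact: straddle_prefix.
  - by move=> n u _; exact: strd.
pose N1 (j : nat) : set Omega := if unpickle j is Some iq then
  [set w | forall n, straddle f (iq : 'I_k * rat).1 (ratr iq.2) (word X n w)]
  else set0.
have mQ (Q : seq E -> Prop) :
    (forall n, measurable [set u : n.-tuple E | Q u]) ->
    measurable [set w | forall n, Q (word X n w)].
  move=> mQ; rewrite (_ : mkset _ = \bigcap_n
      (word X n @^-1` [set u : n.-tuple E | Q u])).
    apply: bigcapT_measurable => n; rewrite -[Y in measurable Y]setTI.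
    exact: (@measurable_word _ _ _ _ _ _ X n measurableT _ (mQ n)).
  by apply/seteqP; split=> [w Qw n _|w Qw n]; exact: Qw.
have : P.-negligible (\bigcup_j N1 j `|`
    [set w | forall n, ~ bounded_image f (word X n w)]).
  apply: negligibleU.
    apply: negligible_bigcup => j; rewrite /N1.
    case: unpickle => [[i q]|] /=; last first.
      exact: negligible_set0.
    exists [set w | forall n, straddle f i (ratr q) (word X n w)]; split => //.
    by apply: mQ => n; exact: measurable_straddle.
  exists [set w | forall n, ~ bounded_image f (word X n w)]; split => //.
  apply: (mQ (fun u => ~ bounded_image f u)) => n.
  by apply: measurableC; exact: measurable_bounded.
move=> [N [mN N0 sub]]; exists N; split => // w Nw.
split=> [|i q].
  by apply: contrapT => /forallNP nb; apply/Nw/sub; right.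
apply: contrapT => /forallNP ns; apply/Nw/sub; left.
exists (pickle (i, q)) => //; rewrite /N1 pickleK /= => n.
exact: contrapT (ns n).
Qed.

(** The limit is redefined as a fixed point x0 of S on the exceptional set, so
    that it is everywhere the pointwise limit of measurable maps. *)
Lemma limit_map : exists pi : {mfun Omega >-> T}, exists N : set Omega,
  [/\ measurable N, P N = 0%E &
      forall w x, ~ N w -> F n w x @[n --> \oo] --> pi w].
Proof.
have [N [mN N0 Nw]] := shrinking_ae.
pose x0 : T := point.
have cvgF w i : ~ N w ->
    exists l : R, forall x, scoord i (F n w x) @[n --> \oo] --> l.
  move=> /Nw[[n bn] ns].
  apply: (nested_ranges_cvg x0) => [m m' x mm'||q].
  - have [v ->] := word_prefix w mm'; exists (maps_comp f v x).
    by rewrite maps_comp_cat.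
  - by exists n; exact: bn.
  - have [m /not_andP[/forallNP ns1|/forallNP ns1]] := ns i q; exists m;
      [left|right] => x.
      by rewrite leNgt; apply/negP; exact: ns1.
    by rewrite leNgt; apply/negP; exact: ns1.
have exl w : exists l : T, if w \in N then l = x0 else
    forall x, F n w x @[n --> \oo] --> l.
  have [wN|/negP wN] := boolP (w \in N); first by exists x0.
  have /choice[l ll] i := cvgF w i (contra_not (@mem_set _ _ _) wN).
  have [y yl] := @closed_coord _ _ _ S0 (fun n => F n w x0) l clS
    (fun i => ll i x0).
  exists y => x; apply: cvg_coord => i; rewrite yl; exact: ll.
have [pi0 pi0P] := choice exl.
have mpi0 : measurable_fun setT pi0.
  apply: measurable_fun_coord => i.
  apply: (@measurable_fun_cvg _ _ _ _
    (fun n w => scoord i (if w \in N then x0 else F n w x0))).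
    move=> n; apply: measurableT_comp; first exact: coord_measurable.
    apply: measurable_fun_ifT => //.
      apply: (measurable_fun_bool true); rewrite setTI.
      rewrite (_ : _ @^-1` _ = N)//.
      by apply/seteqP; split=> w; [exact: set_mem|exact: mem_set].
    exact: measurable_maps_word.
  move=> w _ /=; have := pi0P w; case: ifP => _; first by move=> ->; exact: cvg_cst.
  move=> /(_ x0) cw.
  apply: (@continuous_cvg _ _ _ _ _ _ (scoord i)) cw.
  exact: coord_continuous_substate.
exists (mfun_Sub (mem_set mpi0)), N; split => // w x nNw.
by have := pi0P w; rewrite memNset//; apply.
Qed.

End convergence.

(** * Laws and dominated convergence *)

(** A relation rather than an equality of measures: the members of an iteration
    of the Markov operator are only known to coincide with image measures on
    measurable sets, and the map h need not come with a bundled measurability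
    proof. *)
Definition has_law d d' (Y : measurableType d) (Z : measurableType d') (R : realType)
    (m : probability Z R) (Q : probability Y R) (h : Y -> Z) : Prop :=
  measurable_fun setT h /\ forall A, measurable A -> m A = Q (h @^-1` A).

Section laws.
Context d d' (Y : measurableType d) (Z : measurableType d') (R : realType).
Variables (m : probability Z R) (Q : probability Y R) (h : Y -> Z).
Hypothesis mQh : has_law m Q h.

Lemma ge0_integral_law (g : Z -> \bar R) : measurable_fun setT g ->
  (forall z, (0 <= g z)%E) -> (\int[m]_z g z = \int[Q]_y g (h y))%E.
Proof.
case: mQh => mh mE mg g0; pose h' := mfun_Sub (mem_set mh).
rewrite (@eq_measure_integral _ _ _ _ (distribution Q h')).
  by rewrite /distribution ge0_integral_pushforward.
by move=> A mA _; exact: mE.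
Qed.

Lemma integral_law (g : Z -> R) : measurable_fun setT g -> bounded_fun g ->
  (\int[m]_z (g z)%:E = \int[Q]_y (g (h y))%:E)%E.
Proof.
case: mQh => mh mE mg bg; pose h' := mfun_Sub (mem_set mh).
rewrite (@eq_measure_integral _ _ _ _ (distribution Q h')); last first.
  by move=> A mA _; exact: mE.
rewrite /distribution integral_pushforward// ?preimage_setT//.
  exact/measurable_EFinP.
apply: measurable_bounded_integrable => //.
- by apply: le_lt_trans (ltry 1); exact: probability_le1.
- exact: measurableT_comp.
- have [M [Mr bM]] := bg; exists M; split => // x Mx y _ /=.
  exact: bM.
Qed.

End laws.

Lemma bounded_dominated_cvg d (Y : measurableType d) (R : realType)
  (Q : probability Y R) (u : nat -> Y -> R) (v : Y -> R) (C : R) :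
  (forall n, measurable_fun setT (u n)) -> measurable_fun setT v ->
  (forall n y, `|u n y| <= C) ->
  {ae Q, forall y, u n y @[n --> \oo] --> v y} ->
  (\int[Q]_y (u n y)%:E @[n --> \oo] --> \int[Q]_y (v y)%:E)%E.
Proof.
move=> mu mv uC uv.
have [] // := @dominated_convergence _ Y R Q setT measurableT
  (fun n y => (u n y)%:E) (fun y => (v y)%:E) (fun=> C%:E).
- by move=> n; exact/measurable_EFinP.
- exact/measurable_EFinP.
- by apply: filterS uv => y uvy _; apply: cvg_EFin; [exact: nearW|exact: uvy].
- exact: finite_measure_integrable_cst.
- by apply: aeW => y n _; rewrite abse_EFin lee_fin.
Qed.

(** * Weak convergence on the state space *)

Section real_continuity.
Context (R : realType) (X : topologicalType).
Implicit Types g h : X -> R.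

Lemma continuous_mulr g h : continuous g -> continuous h ->
  continuous (fun x => g x * h x).
Proof. by move=> cg ch x; apply: cvgM; [exact: cg|exact: ch]. Qed.

Lemma continuous_tent g (q r : R) : continuous g ->
  continuous (fun x => Num.max 0 (r - `|q - g x|)).
Proof.
move=> cg.
have cr : continuous (fun x => r - `|q - g x|).
  move=> x; apply: cvgB; first exact: cvg_cst.
  by apply: cvg_norm; apply: cvgB; [exact: cvg_cst|exact: cg].
rewrite (_ : (fun x => _) = (fun x => (0 + (r - `|q - g x|) +
  `|0 - (r - `|q - g x|)|) / 2)); last by apply/funext => x; rewrite maxr_absE.
move=> x; apply: cvgM; last exact: cvg_cst.
apply: cvgD; first by apply: cvgD; [exact: cvg_cst|exact: cr].
by apply: cvg_norm; apply: cvgB; [exact: cvg_cst|exact: cr].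
Qed.

Lemma continuous_complX g n : continuous g ->
  continuous (fun x => 1 - (1 - g x) ^+ n).
Proof.
move=> cg x; apply: cvgB; first exact: cvg_cst.
elim: n => [|n IH]; first by under eq_fun do rewrite expr0; exact: cvg_cst.
under eq_fun do rewrite exprS.
by rewrite exprS; apply: cvgM => //; apply: cvgB; [exact: cvg_cst|exact: cg].
Qed.

End real_continuity.

Section weak_convergence.
Context (R : realType) (k : nat) (S : set 'rV[R]_k) (S0 : S !=set0).
Local Notation T := (substate S0).

Lemma bounded_funW (Y : Type) (g : Y -> R) : bounded_fun g ->
  exists C, forall y, `|g y| <= C.
Proof.
by move=> [M [_ bM]]; exists (M + 1) => y; apply: bM => //; rewrite ltrDl.
Qed.

Lemma law_weak_cvg d (Y : measurableType d) (Q : probability Y R)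
  (m_ : nat -> probability T R) (m : probability T R)
  (h_ : nat -> Y -> T) (h : Y -> T) :
  (forall n, has_law (m_ n) Q (h_ n)) -> has_law m Q h ->
  {ae Q, forall y, h_ n y @[n --> \oo] --> h y} -> weak_cvg m_ m.
Proof.
move=> law_ law hh g cg bg; have mg := continuous_measurable_substate cg.
rewrite (integral_law law mg bg).
under eq_fun do rewrite (integral_law (law_ _) mg bg).
have [C gC] := bounded_funW bg.
apply: (@bounded_dominated_cvg _ _ _ _ _ _ C) => //.
- by move=> n; apply: measurableT_comp => //; case: (law_ n).
- by apply: measurableT_comp => //; case: law.
- apply: filterS hh => y hy; apply: (continuous_cvg _ _ hy); exact: cg.
Qed.

(** A pi-system that generates the Borel sets and whose members have indicator
    functions approximated by continuous ones: if U = {g > 0} with values of g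
    in [0, 1], then 1 - (1 - g)^n increases to the indicator of U. *)
Definition cozero : set_system T := [set U | exists g : T -> R,
  [/\ continuous g, forall x, 0 <= g x <= 1 & U = [set x | 0 < g x]]].

Lemma cozero_coord_ball i (q r : R) : r <= 1 ->
  cozero [set x : T | ball q r (scoord i x)].
Proof.
move=> r1; exists (fun x => Num.max 0 (r - `|q - scoord i x|)); split.
- by apply: continuous_tent; exact: coord_continuous_substate.
- move=> x; rewrite le_max lexx /= ge_max ler01 /=.
  by rewrite lerBlDr (le_trans r1)// lerDl.
- by apply/seteqP; split=> x /=; rewrite /ball/= lt_max ltxx /= subr_gt0.
Qed.

Lemma measurable_cozero : @measurable _ T = <<s cozero >>.
Proof.
apply/seteqP; split; last first.
  apply: smallest_sub; first exact: sigma_algebra_measurable.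
  move=> _ [g [cg _ ->]]; apply: sub_sigma_algebra.
  by apply: (@open_comp _ _ g [set r | 0 < r]) => [x _|];
     [exact: cg|exact: open_gt].
apply: smallest_sub; first exact: smallest_sigma_algebra.
pose TG : measurableType _ := g_sigma_algebraType cozero.
move=> U oU; rewrite (open_bigcup_box oU).
suff : @measurable _ TG (\bigcup_(p in [set p | box p `<=` U]) box p) by [].
rewrite bigcup_mkcond; apply: countable_bigcupT_measurable => // p.
case: ifP => // _.
rewrite (_ : box p = \bigcap_(i : 'I_k)
  [set x : T | ball (ratr (p.1 ord0 i) : R) p.2.+1%:R^-1 (scoord i x)]).
  apply: fin_bigcap_measurable => // i _; apply: sub_sigma_algebra.
  by apply: cozero_coord_ball; rewrite invf_le1// ler1n.
by apply/seteqP; split=> [x px i _|x px i]; exact: px.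
Qed.

Lemma measure_eq_continuous (m1 m2 : probability T R) :
  (forall g : T -> R, continuous g -> bounded_fun g ->
    (\int[m1]_x (g x)%:E = \int[m2]_x (g x)%:E)%E) -> m1 ≡μ m2.
Proof.
move=> m12 A mA; apply: (@measure_unique _ _ _ cozero (fun=> setT)) => //.
- exact: measurable_cozero.
- move=> _ _ [g1 [cg1 g1b ->]] [g2 [cg2 g2b ->]].
  exists (fun x => g1 x * g2 x); split.
  + exact: continuous_mulr.
  + move=> x; have /andP[? ?] := g1b x; have /andP[? ?] := g2b x.
    by rewrite mulr_ge0// mulr_ile1.
  + apply/seteqP; split=> x /=; first by move=> [? ?]; rewrite mulr_gt0.
    have /andP[g10 _] := g1b x; have /andP[g20 _] := g2b x.
    rewrite lt0r mulf_eq0 negb_or -andbA => /and3P[? ? _].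
    by rewrite !lt0r g10 g20 !andbT.
- move=> _; exists (fun=> 1); split=> [|x|]; first exact: cst_continuous.
    by rewrite ler01 lexx.
  by apply/seteqP; split=> x //=; rewrite ltr01.
- by rewrite bigcup_const//; exists 0%N.
- move=> U [g [cg gb UE]].
  pose u n x := 1 - (1 - g x) ^+ n.
  have uX n x : 0 <= (1 - g x) ^+ n <= 1.
    have /andP[? ?] := gb x.
    by rewrite exprn_ge0 ?subr_ge0// exprn_ile1 ?subr_ge0// lerBlDr lerDl.
  have cu n : continuous (u n).
    exact: continuous_complX.
  have u1 n x : `|u n x| <= 1.
    have /andP[? ?] := uX n x; rewrite /u ger0_norm ?subr_ge0//.
    by rewrite lerBlDr lerDl.
  have bu n : bounded_fun (u n).
    by exists 1; split => // M M1 x _; exact: le_trans (u1 n x) (ltW M1).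
  have uU x : u n x @[n --> \oo] --> (\1_U x : R).
    rewrite indicE; have /andP[g0 g1] := gb x.
    have [/set_mem|/negP xU] := boolP (x \in U).
      rewrite UE /= => gx; rewrite -[X in _ --> X]subr0; apply: cvgB.
        exact: cvg_cst.
      by apply: cvg_expr; rewrite ger0_norm ?subr_ge0// ltrBlDr ltrDl.
    have gx0 : g x = 0.
      apply/eqP; rewrite eq_le g0 andbT leNgt; apply/negP => gx; apply: xU.
      by rewrite UE inE.
    rewrite /u gx0 subr0.
    by under eq_fun do rewrite expr1n subrr; exact: cvg_cst.
  have mU : measurable U.
    rewrite UE; apply: sub_sigma_algebra.
    by apply: (@open_comp _ _ g [set r | 0 < r]) => [x _|];
       [exact: cg|exact: open_gt].
  have lim (m : probability T R) : (\int[m]_x (u n x)%:E @[n --> \oo] --> m U)%E.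
    rewrite -[m U]/(m U) -(setIT U) -integral_indic//.
    apply: (@bounded_dominated_cvg _ _ _ _ _ _ 1) => //.
    + by move=> n; exact: continuous_measurable_substate.
    + exact: aeW.
  have l2 := lim m2.
  rewrite (_ : (fun n => _) = (fun n => \int[m1]_x (u n x)%:E)%E) in l2.
    exact: (cvg_unique _ (lim m1) l2).
  by apply/funext => n; rewrite m12.
- by move=> _; rewrite [ltLHS]probability_setT ltry.
Qed.

End weak_convergence.

(** * Laws of the iterates of the Markov operator *)

(** Integrating over the first letter innermost, whereas the inductive definition
    of the powers integrates it outermost: the Markov operator applies the newest
    random map on the outside, as the first letter of the word. *)
Lemma power_probability_cons d (E : measurableType d) (R : realType)
    (nu : probability E R) n (C : set (n.+1.-tuple E)) : measurable C ->
  power_probability nu n.+1 C =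
  (\int[power_probability nu n]_u nu [set a | C [tuple of a :: u]])%E.
Proof.
move=> mC; pose B := tuple_cons (E := E) (n := n) @^-1` C.
have mB : measurable B.
  by rewrite -[X in measurable X]setTI; exact: measurable_tuple_cons.
transitivity ((nu \x^ power_probability nu n)%E B).
  apply: product_measure_unique => // A1 A2 mA1 mA2; exact: product_measure2E.
apply: eq_integral => u _ /=; congr (nu _).
by apply/seteqP; split=> a /=; rewrite /ysection/= inE.
Qed.

Section markov_laws.
Context (R : realType) (dE d : measure_display) (E : measurableType dE)
  (S : measurableType d) (nu : probability E R) (f : {mfun (E * S)%type >-> S}).
Local Notation pw := (power_probability nu).

Lemma trans_probE x A : measurable A ->
  trans_prob nu f x A = nu [set a | A (f (a, x))].
Proof.
move=> mA; rewrite /trans_prob -(setIT [set a | _]) -integral_indic//.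
rewrite -[X in measurable X]setTI.
exact: (measurableT_comp (measurable_funPT f) (pair2_measurable x)).
Qed.

(** One step of the chain from h(y) applies f_a with a drawn independently of
    y. *)
Lemma markov_law dY (Y : measurableType dY) (Q : probability Y R)
    (h : Y -> S) (m : probability S R) : has_law m Q h ->
  has_law (markov_op nu f m) (product_probability Q nu)
    (fun z => f (z.2, h z.1)).
Proof.
move=> mQh; have [mh _] := mQh.
have mfh : measurable_fun setT (fun z : Y * E => f (z.2, h z.1)).
  apply: (measurableT_comp (measurable_funPT f)).
  by apply: measurable_fun_pair => //; exact: measurableT_comp.
split=> // A mA.
rewrite -[LHS]/(\int[m]_x trans_prob nu f x A)%E (ge0_integral_law mQh).
- apply: eq_integral => y _ /=; rewrite trans_probE//; congr (nu _).
  by apply/seteqP; split=> a /=; rewrite /xsection/= inE.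
- have mB : measurable [set z : S * E | A (f (z.2, z.1))].
    rewrite -[X in measurable X]setTI.
    apply: (measurableT_comp (measurable_funPT f)) => //.
    exact: measurable_fun_pair.
  rewrite (_ : trans_prob nu f ^~ A =
      nu \o xsection [set z : S * E | A (f (z.2, z.1))]).
    exact: measurable_fun_xsection.
  apply/funext => x; rewrite trans_probE//=; congr (nu _).
  by apply/seteqP; split=> a /=; rewrite /xsection/= inE.
- by move=> x; apply: integral_ge0 => a _; rewrite lee_fin.
Qed.

End markov_laws.

Section iterates.
Context (R : realType) (k : nat) (S : set 'rV[R]_k) (S0 : S !=set0)
  (dE : measure_display) (E : measurableType dE) (nu : probability E R)
  (f : {mfun (E * substate S0)%type >-> substate S0}).
Local Notation T := (substate S0).
Local Notation pw := (power_probability nu).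

Lemma measurable_maps_swap n :
  measurable_fun setT (fun z : T * n.-tuple E => maps_comp f z.2 z.1).
Proof.
exact: (measurableT_comp (@measurable_maps_comp_tuple _ _ _ _ _ _ f n)
  (measurable_fun_pair measurable_snd measurable_fst)).
Qed.

Lemma measurable_maps_set n x (A : set T) : measurable A ->
  measurable [set u : n.-tuple E | A (maps_comp f u x)].
Proof.
move=> mA; rewrite -[X in measurable X]setTI.
exact: (measurableT_comp (@measurable_maps_swap n) (pair1_measurable x)).
Qed.

Lemma iter_markov_law n (s : probability T R) :
  has_law (iter n (markov_op nu f) s) (product_probability s (pw n))
    (fun z => maps_comp f z.2 z.1).
Proof.
elim: n => [|n IH]; split; try exact: measurable_maps_swap.
  move=> A mA; rewrite (_ : _ @^-1` _ = A `*` setT).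
    by rewrite [RHS]product_measure1E// [X in (_ * X)%E]probability_setT mule1.
  by apply/seteqP; split=> -[x u] /=; rewrite (tuple0 u) //= => -[].
have [mh lawE] := markov_law nu f IH.
move=> A mA; rewrite iterS lawE//.
have mpre : measurable ((fun z : (T * n.-tuple E) * E =>
    f (z.2, maps_comp f z.1.2 z.1.1)) @^-1` A).
  by rewrite -[X in measurable X]setTI; exact: mh.
rewrite [LHS](fubini_tonelli1 (m1 := s) (m2 := pw n)
  (nu \o xsection ((fun z : (T * n.-tuple E) * E =>
    f (z.2, maps_comp f z.1.2 z.1.1)) @^-1` A))); last 2 first.
- exact: measurable_fun_xsection.
- by move=> z; exact: measure_ge0.
apply: eq_integral => x _ /=; rewrite /fubini_F /=.
rewrite (_ : xsection _ x = [set u : n.+1.-tuple E | A (maps_comp f u x)]); last first.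
  by apply/seteqP; split=> u /=; rewrite /xsection/= inE.
rewrite [RHS]power_probability_cons; last exact: measurable_maps_set.
apply: eq_integral => u _; congr (nu _).
by apply/seteqP; split=> a /=; rewrite /xsection/= inE.
Qed.

Section on_Omega.
Context (dO : measure_display) (Omega : measurableType dO)
  (P : probability Omega R) (X : nat -> {RV P >-> E}) (iidX : iid nu X).

(** The n-th state of the chain started from s has the same law as the backward
    composition f_(X_0) o ... o f_(X_(n-1)), although the two processes are
    different. *)
Lemma iter_markov_word n (s : probability T R) :
  has_law (iter n (markov_op nu f) s) (product_probability s P)
    (fun z => maps_comp f (word X n z.2) z.1).
Proof.
have [_ lawE] := iter_markov_law n s.
split=> [|A mA].
  apply: (measurableT_comp (@measurable_maps_swap n)
    (g := fun z : T * Omega => (z.1, word X n z.2))).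
  apply: measurable_fun_pair => //; apply: measurableT_comp => //.
  exact: measurable_word.
rewrite lawE//; apply: eq_integral => x _ /=.
transitivity (pw n [set u : n.-tuple E | A (maps_comp f u x)]).
  by congr (pw n _); apply/seteqP; split=> u /=; rewrite /xsection/= inE.
rewrite -(word_law iidX) //; last exact: measurable_maps_set.
by congr (P _); apply/seteqP; split=> u /=; rewrite /xsection/= inE.
Qed.

End on_Omega.
End iterates.

(** * The theorem *)

Theorem theorem1 (R : realType) (k : nat) (J : {set 'I_k})
  (S : set 'rV[R]_k) (S0 : S !=set0) (cS : connected S) (clS : closed S)
  (dE : measure_display) (E : measurableType dE) (nu : probability E R)
  (dO : measure_display) (Omega : measurableType dO) (P : probability Omega R)
  (X : nat -> {RV P >-> E}) (iidX : iid nu X)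
  (f : {mfun (E * substate S0)%type >-> substate S0})
  (fcont : forall a : E, continuous (fun x : substate S0 => f (a, x)))
  (fmono : forall a : E, J_monotone J (fun x : substate S0 => f (a, x)))
  (fsplit : J_splitting J nu f) :
  exists pi : {mfun Omega >-> substate S0},
    [/\ {ae P, forall w, forall x : substate S0,
          maps_comp f [seq X i w | i <- iota 0 n.+1] x @[n --> \oo] --> pi w},
        stationary nu f (distribution P pi),
        (forall mu : probability (substate S0) R,
          stationary nu f mu -> mu ≡μ distribution P pi) &
        forall mu : probability (substate S0) R,
          weak_cvg (fun n => iter n (markov_op nu f) mu) (distribution P pi)].
Proof.
have [pi [N [mN N0 Fpi]]] := limit_map clS iidX fcont fmono fsplit.
have null_snd d (Y : measurableType d) (s : probability Y R) :
    product_probability s P ([set: Y] `*` N) = 0%E.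
  by rewrite [LHS]product_measure1E// [X in (_ * X)%E]N0 mule0.
have pi_law (s : probability (substate S0) R) :
    has_law (distribution P pi) (product_probability s P) (fun z => pi z.2).
  split; first exact: measurableT_comp.
  move=> A mA; rewrite (_ : _ @^-1` A = setT `*` (pi @^-1` A)).
    rewrite [RHS]product_measure1E//; last first.
      by rewrite -[X in measurable X]setTI; exact: measurable_funPT.
    by rewrite [X in (X * _)%E]probability_setT mul1e.
  by apply/seteqP; split=> [[x w] /=|[x w] [] //].
have weak (mu : probability (substate S0) R) :
    weak_cvg (fun n => iter n (markov_op nu f) mu) (distribution P pi).
  have L n := iter_markov_word f iidX n mu.
  apply: (law_weak_cvg L (pi_law mu)).
  exists (setT `*` N); split => //; first exact: measurableX.
  move=> [x w] /= nxw; split => //; apply: contrapT => nw; apply: nxw.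
  exact: Fpi.
(* The same sequence, shifted by one and written as T applied to T^n mu. *)
have weakS (mu : probability (substate S0) R) :
    weak_cvg (fun n => iter n.+1 (markov_op nu f) mu)
      (markov_op nu f (distribution P pi)).
  have L n := markov_law nu f (iter_markov_word f iidX n mu).
  apply: (law_weak_cvg L (markov_law nu f (pi_law mu))).
  exists ((setT `*` N) `*` setT); split.
  - by apply: measurableX => //; exact: measurableX.
  - rewrite [LHS]product_measure1E//; last exact: measurableX.
    by rewrite [X in (X * _)%E]null_snd mul0e.
  - move=> [[x w] a] /= nxw; split => //; split => //; apply: contrapT => nw; apply: nxw.
    apply: (@continuous_cvg _ _ _ _ _ _ (fun x => f (a, x))) (Fpi w x nw).
    exact: fcont.
exists pi; split => //.
- exists N; split => // w; apply: contra_notP => nN x.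
  have := Fpi w x nN.
  by rewrite -cvg_shiftS.
- apply: measure_eq_continuous => g cg bg.
  have w1 := weakS (distribution P pi) g cg bg.
  have := weak (distribution P pi) g cg bg.
  by rewrite -cvg_shiftS => /(cvg_unique _ w1); exact.
- move=> mu smu; apply: measure_eq_continuous => g cg bg.
  have smun n : iter n (markov_op nu f) mu ≡μ mu.
    elim: n => [//|n IH] A mA; rewrite iterS -(smu A mA).
    apply: eq_measure_integral => B mB _; exact: IH.
  have := weak mu g cg bg.
  rewrite (_ : (fun n => _) = cst (\int[mu]_x (g x)%:E)%E).
    by apply: cvg_unique => //; exact: cvg_cst.
  by apply/funext => n; apply: eq_measure_integral => B mB _; exact: smun.
Qed.
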